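(* Let $\mathscr{F}\subseteq\mathscr{P}(\omega)$ be an $\omega$-closed family. The semigroup $\boldsymbol{B}_{\mathbb{Z}}^{\mathscr{F}}$ is isomorphic to the semigroup of $\omega\times\omega$-matrix units $\boldsymbol{\mathcal{B}}_\omega$ if and only if $\mathscr{F}=\{F,\varnothing\}$, where $F$ is a one-point subset of $\omega$.
   Context: $\omega$ is the set of non-negative integers and $\mathscr{P}(\omega)$ is the family of all its subsets. For $n\in\mathbb{Z}$ and $A\subseteq\mathbb{Z}$ put $n+A=\{n+a: a\in A\}$ (so $n+\varnothing=\varnothing$). A family $\mathscr{F}\subseteq\mathscr{P}(\omega)$ is $\omega$-closed if $F_1\cap(-n+F_2)\in\mathscr{F}$ for all $n\in\omega$ and $F_1,F_2\in\mathscr{F}$. For an $\omega$-closed family $\mathscr{F}$, the set $\mathbb{Z}\times\mathbb{Z}\times\mathscr{F}$ carries the associative operation $$(i_1,j_1,F_1)\cdot(i_2,j_2,F_2)=\begin{cases}(i_1-j_1+i_2,\;j_2,\;(j_1-i_2+F_1)\cap F_2), & j_1<i_2;\\ (i_1,\;j_2,\;F_1\cap F_2), & j_1=i_2;\\ (i_1,\;j_1-i_2+j_2,\;F_1\cap(i_2-j_1+F_2)), & j_1>i_2.\end{cases}$$ If $\varnothing\in\mathscr{F}$, then $\boldsymbol{I}=\{(i,j,\varnothing): i,j\in\mathbb{Z}\}$ is an ideal and $\boldsymbol{B}_{\mathbb{Z}}^{\mathscr{F}}$ is defined as the Rees quotient $(\mathbb{Z}\times\mathbb{Z}\times\mathscr{F},\cdot)/\boldsymbol{I}$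 ($\boldsymbol{I}$ is collapsed to one element, the zero); if $\varnothing\notin\mathscr{F}$, then $\boldsymbol{B}_{\mathbb{Z}}^{\mathscr{F}}=(\mathbb{Z}\times\mathbb{Z}\times\mathscr{F},\cdot)$. The semigroup of $\omega\times\omega$-matrix units is $\boldsymbol{\mathcal{B}}_\omega=(\omega\times\omega)\sqcup\{0\}$ with $(a,b)\cdot(c,d)=(a,d)$ if $b=c$, $(a,b)\cdot(c,d)=0$ if $b\neq c$, and $(a,b)\cdot0=0\cdot(a,b)=0\cdot0=0$ for $a,b,c,d\in\omega$. *)

(* Defs.v *)
From HB Require Import structures.
From mathcomp Require Import all_boot all_order all_algebra.
From mathcomp Require Import boolp classical_sets.
From mathcomp Require Import zify.
Set Implicit Arguments.
Unset Strict Implicit.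
Unset Printing Implicit Defensive.
Import Order.TTheory GRing.Theory Num.Theory.
Local Open Scope classical_set_scope.
Local Open Scope ring_scope.
Local Open Scope quotient_scope.

Definition isomorphic (S T : semigroupType) : Prop :=
  exists f : {multiplicative S -> T}, bijective f.

Definition is_ideal (S : semigroupType) (I : set S) : Prop :=
  I !=set0 /\ forall x y : S, I x \/ I y -> I (x * y)%g.

(* The Rees congruence of I: it collapses I to one class. *)
Definition rees_rel (S : semigroupType) (I : set S) : rel S :=
  fun x y => (x == y) || (x \in I) && (y \in I).

Section ReesQuotient.
Variables (S : semigroupType) (I : set S) (Iideal : is_ideal I).

Lemma rees_rel_refl : reflexive (rees_rel I).
Proof. by move=> x; rewrite /rees_rel eqxx. Qed.

Lemma rees_rel_sym : symmetric (rees_rel I).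
Proof. by move=> x y; rewrite /rees_rel eq_sym andbC. Qed.

Lemma rees_rel_trans : transitive (rees_rel I).
Proof.
move=> y x z /orP[/eqP-> //|/andP[Ix Iy]] /orP[/eqP<-|/andP[_ Iz]].
  by rewrite /rees_rel Ix Iy orbT.
by rewrite /rees_rel Ix Iz orbT.
Qed.

Canonical rees_equiv :=
  EquivRel (rees_rel I) rees_rel_refl rees_rel_sym rees_rel_trans.

Definition rees_quotient of is_ideal I := {eq_quot rees_equiv}.

Local Notation Q := (rees_quotient Iideal).

HB.instance Definition _ := Choice.on Q.
HB.instance Definition _ := EqQuotient.on Q.

Definition rees_mul : Q -> Q -> Q := lift_op2 Q *%g.

Lemma rees_mulE (x y : S) : rees_mul (\pi_Q x) (\pi_Q y) = \pi_Q (x * y)%g.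
Proof.
have H (z : S) : rees_rel I (repr (\pi_Q z)) z.
  by apply/(@eqquotP _ rees_equiv Q); rewrite reprK.
have -> (a b : Q) : rees_mul a b = \pi_Q (repr a * repr b)%g.
  by rewrite /rees_mul; unlock.
apply/(@eqquotP _ rees_equiv Q).
have [_ II] := Iideal.
case/orP: (H x) => [/eqP->|/andP[/set_mem Ia /set_mem Ix]].
  case/orP: (H y) => [/eqP->|/andP[/set_mem Ib /set_mem Iy]].
    exact: rees_rel_refl.
  by apply/orP; right; apply/andP; split; apply/mem_set; apply: II; right.
by apply/orP; right; apply/andP; split; apply/mem_set; apply: II; left.
Qed.

Lemma rees_mulA : associative rees_mul.
Proof.
by move=> x y z; rewrite -[x]reprK -[y]reprK -[z]reprK !rees_mulE mulgA.
Qed.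

HB.instance Definition _ := isSemigroup.Build Q rees_mulA.

End ReesQuotient.

(* Subsets of omega are represented as sets of nonnegative integers, so that
   the translate n + A makes sense for every n in Z. *)
Definition omega : set int := [set n | 0 <= n].

Definition shift (n : int) (A : set int) : set int := [set n + a | a in A].

Definition omega_closed (F : set (set int)) : Prop :=
  forall (n : nat) (F1 F2 : set int),
    F F1 -> F F2 -> F (F1 `&` shift (- n%:Z) F2).

(* Defined on all of Z x Z x P(Z); the semigroup below restricts the third
   component to an omega-closed family. *)
Definition triple_mul (x y : int * int * set int) : int * int * set int :=
  let: (i1, j1, F1) := x in
  let: (i2, j2, F2) := y in
  if j1 < i2 then (i1 - j1 + i2, j2, shift (j1 - i2) F1 `&` F2)
  else if j1 == i2 then (i1, j2, F1 `&` F2)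
  else (i1, j1 - i2 + j2, F1 `&` shift (i2 - j1) F2).

Lemma shiftE n A a : shift n A a <-> A (a - n).
Proof.
split=> [[b Ab <-]|Aa]; first by rewrite addrC addKr.
by exists (a - n); rewrite // addrC subrK.
Qed.

Lemma shift0 A : shift 0 A = A.
Proof. by apply/predeqP => a; rewrite shiftE subr0. Qed.

(* A uniform formula for the three cases, with m = max(j1, i2). *)
Lemma triple_mulE i1 j1 F1 i2 j2 F2 :
  triple_mul (i1, j1, F1) (i2, j2, F2) =
  (i1 - j1 + Num.max j1 i2, Num.max j1 i2 - i2 + j2,
   shift (j1 - Num.max j1 i2) F1 `&` shift (i2 - Num.max j1 i2) F2).
Proof.
rewrite /triple_mul; case: ltgtP => [lt|gt|->].
- by rewrite !subrr shift0 add0r.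
- by rewrite !subrr shift0 subrK.
- by rewrite !subrr !shift0 subrK add0r.
Qed.

Lemma triple_mulA : associative triple_mul.
Proof.
move=> [[i1 j1] F1] [[i2 j2] F2] [[i3 j3] F3]; rewrite !triple_mulE.
set m := Num.max j1 i2; set n := Num.max j2 i3.
set p := Num.max j1 _; set q := Num.max _ i3.
have pq : p - i2 = q - j2 by rewrite /p /q /m /n; lia.
congr (_, _, _); try by lia.
apply/predeqP => a; split => /=.
  case=> /shiftE A1 /shiftE[/shiftE A2 /shiftE A3]; split.
    apply/shiftE; split; apply/shiftE.
      by move: A1; congr (F1 _); lia.
    by move: A2; congr (F2 _); lia.
  by apply/shiftE; move: A3; congr (F3 _); lia.
case=> /shiftE[/shiftE A1 /shiftE A2] /shiftE A3; split.
  by apply/shiftE; move: A1; congr (F1 _); lia.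
apply/shiftE; split; apply/shiftE.
  by move: A2; congr (F2 _); lia.
by move: A3; congr (F3 _); lia.
Qed.

Section BZ.
Variables (F : set (set int)) (Fclosed : omega_closed F).

Lemma triple_mul_closed (x y : int * int * set int) :
  F x.2 -> F y.2 -> F (triple_mul x y).2.
Proof.
case: x y => [[i1 j1] F1] [[i2 j2] F2] /= FF1 FF2; case: ltgtP => /= lt.
- have -> : j1 - i2 = - `|i2 - j1|%N%:Z by lia.
  by rewrite setIC; apply: Fclosed.
- have -> : i2 - j1 = - `|i2 - j1|%N%:Z by lia.
  exact: Fclosed.
- by rewrite -(shift0 F2) -oppr0; apply: (@Fclosed 0).
Qed.

Definition triples of omega_closed F : Type :=
  {x : int * int * set int | x.2 \in F}.

Local Notation T := (triples Fclosed).

HB.instance Definition _ := SubChoice.on T.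

Lemma triples_mul_subproof (x y : T) : (triple_mul (val x) (val y)).2 \in F.
Proof.
by apply/mem_set/triple_mul_closed; apply: set_mem; apply: (valP (_ : T)).
Qed.

Definition triples_mul (x y : T) : T :=
  exist _ (triple_mul (val x) (val y)) (triples_mul_subproof x y).

Lemma triples_mulA : associative triples_mul.
Proof. by move=> x y z; apply: val_inj; apply: triple_mulA. Qed.

HB.instance Definition _ := isSemigroup.Build T triples_mulA.

Definition empty_triples : set T := [set x | (val x).2 = set0].

Lemma empty_triples_ideal : F set0 -> is_ideal empty_triples.
Proof.
move=> F0; split.
  by exists (exist _ (0 : int, 0 : int, set0) (mem_set F0)).
move=> x y; rewrite /empty_triples /=.
case: (val x) (val y) => [[i1 j1] F1] [[i2 j2] F2] /=.
have s0 n : shift n set0 = set0 by apply: image_set0.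
by case=> ->; case: ltgtP => _ /=; rewrite ?s0 ?set0I ?setI0.
Qed.

(* The Rees quotient is taken only when set0 is in F: otherwise the set of
   triples (i, j, set0) is empty, hence not an ideal. *)
Definition BZ : semigroupType :=
  match pselect (F set0) with
  | left F0 => rees_quotient (empty_triples_ideal F0)
  | right _ => triples Fclosed
  end.

End BZ.

(* Matrix units; None is the zero and Some (a, b) is the unit (a, b). *)
Definition matrix_units : Type := option (nat * nat).

HB.instance Definition _ := Choice.on matrix_units.

Definition matrix_units_mul (x y : matrix_units) : matrix_units :=
  match x, y with
  | Some (a, b), Some (c, d) => if b == c then Some (a, d) else None
  | _, _ => None
  end.

Lemma matrix_units_mulA : associative matrix_units_mul.
Proof.
move=> [[a b]|] [[c d]|] [[e f]|] //=; try by case: (b == c).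
by have [->|bc] := eqVneq b c; have [de|de] := eqVneq d e;
  rewrite /= ?eqxx ?(negbTE bc) ?de ?eqxx ?(negbTE de).
Qed.

HB.instance Definition _ := isSemigroup.Build matrix_units matrix_units_mulA.

(* Main.v *)
(** Distinct idempotents of the semigroup of matrix units have zero product.
    If [b < a] with [a] in [A], [b] in [B] and [A], [B] in the family, put
    [k = a - b]: the idempotents [(0, 0, A)] and [(k, k, B)] are distinct, and
    the third component of their product contains [b], so the product is
    nonzero. Hence all points of all members of the family coincide.
    Conversely, for a one-point [F] the nonzero triples [(i, j, F)] multiply as
    matrix units indexed by Z, and Z is in bijection with omega. *)
Require Import Defs.
From mathcomp Require Import all_boot all_order all_algebra.
From mathcomp Require Import boolp classical_sets.
From mathcomp Require Import zify.
From HB Require Import structures.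
Set Implicit Arguments.
Unset Strict Implicit.
Unset Printing Implicit Defensive.
Local Open Scope classical_set_scope.
Local Open Scope ring_scope.
Local Open Scope quotient_scope.
Import Order.TTheory GRing.Theory Num.Theory.

(** First isomorphism theorem: the kernel of [g] is the Rees congruence, so [g] descends to an
    injective map on the quotient, and the section [h] provides its inverse. *)
Lemma isomorphic_rees (S T : semigroupType) (I : set S) (Iideal : is_ideal I)
    (g : S -> T) (h : T -> S) :
  {morph g : x y / (x * y)%g} -> (forall x y, rees_rel I x y <-> g x = g y) ->
  cancel h g -> isomorphic (rees_quotient Iideal) T.
Proof.
move=> gM gE hK; set Q := rees_quotient Iideal.
have gpi x : g (repr (\pi_Q x)) = g x.
  by apply/gE/(@eqquotP _ (rees_equiv I) Q); rewrite reprK.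
pose f (q : Q) := g (repr q).
have fM : {morph f : x y / (x * y)%g}.
  apply: quotW => x; apply: quotW => y.
  by rewrite /f [(_ * _)%g]rees_mulE !gpi gM.
pose fm := isMultiplicative.Build Q T f fM.
pose fp : {multiplicative Q -> T} := HB.pack f fm.
exists fp; exists (fun t => \pi_Q (h t)) => [|t] /=.
  apply: quotW => x; rewrite /f gpi.
  by apply/(@eqquotP _ (rees_equiv I) Q)/gE; rewrite hK.
by rewrite /f gpi hK.
Qed.

Lemma rees_pi_eq (S : semigroupType) (I : set S) (Iideal : is_ideal I)
    (x y : S) :
  \pi_(rees_quotient Iideal) x = \pi_(rees_quotient Iideal) y <-> rees_rel I x y.
Proof.
by split=> /(@eqquotP _ (rees_equiv I) (rees_quotient Iideal)).
Qed.

Lemma matrix_units_mulgE (x y : matrix_units) :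
  (x * y)%g = matrix_units_mul x y.
Proof. by []. Qed.

(** The nonzero idempotents are the diagonal units (a, a), and (a, a)(c, c) is zero unless a = c. *)
Lemma matrix_units_idem_orth (e f : matrix_units) :
  (e * e)%g = e -> (f * f)%g = f -> e <> f -> (e * f)%g = None.
Proof.
rewrite !matrix_units_mulgE; case: e => [[a b]|//]; case: f => [[c d]|] //=.
case: eqP => // -> _; case: eqP => // -> _; case: eqP => [-> //|//].
Qed.

Lemma matrix_units_mul0 (x : matrix_units) : (x * None)%g = None :> matrix_units.
Proof. by case: x => [[]|]. Qed.

(** Enumerates the integers as 0, -1, 1, -2, 2, ...: nonnegative ones get even codes, negative ones
    odd codes. *)
Definition nat_of_int (n : int) : nat :=
  match n with Posz k => k.*2 | Negz k => k.*2.+1 end.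

Definition int_of_nat (m : nat) : int :=
  if odd m then Negz m./2 else Posz m./2.

Lemma nat_of_intK : cancel nat_of_int int_of_nat.
Proof.
by case=> n; rewrite /int_of_nat /= odd_double /= ?doubleK ?uphalf_double.
Qed.

Lemma int_of_natK : cancel int_of_nat nat_of_int.
Proof.
move=> m; rewrite -[RHS]odd_double_half /int_of_nat.
by case: (odd m).
Qed.

Section Triples.
Variables (F : set (set int)) (Fclosed : omega_closed F).

Local Notation T := (triples Fclosed).

Definition triple (i j : int) (A : set int) (FA : F A) : T :=
  exist _ (i, j, A) (mem_set FA).

(** Right multiplication of (i, j, A) by (j, j + 1, A) moves the second coordinate to j + 1. Hence
    the semigroup of triples, before any quotient, has no zero. *)
Lemma triples_no_zero (z : T) : exists y : T, (z * y)%g <> z.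
Proof.
case: z => [[[i j] A] FA]; exists (triple j (j + 1) (set_mem FA)).
by move=> /(congr1 val); rewrite /= ltxx eqxx => -[]; lia.
Qed.

Lemma triple_idem (i : int) (A : set int) (FA : F A) :
  (triple i i FA * triple i i FA)%g = triple i i FA.
Proof. by apply: val_inj; rewrite /= ltxx eqxx setIid. Qed.

(** Without the empty set no quotient is taken, and the preimage of [None] would be a zero among the
    triples. *)
Lemma isomorphic_matrix_units_set0 :
  isomorphic (BZ Fclosed) matrix_units -> F set0.
Proof.
rewrite /BZ; case: pselect => [//|_] [f [g fK gK]]; exfalso.
have [y] := triples_no_zero (g None); apply.
apply: (can_inj fK); rewrite gmulfM gK.
by case: (f y) => [[]|].
Qed.

Lemma isomorphic_matrix_units_nonempty :
  isomorphic (BZ Fclosed) matrix_units -> exists2 A, F A & A !=set0.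
Proof.
move=> iso; apply: contrapT => noA.
have F0 := isomorphic_matrix_units_set0 iso.
have allE (x : T) : (val x).2 = set0.
  apply: contrapT => /eqP/set0P xN0; apply: noA.
  by exists (val x).2 => //; apply: set_mem; apply: (valP x).
move: iso; rewrite /BZ; case: pselect => // {}F0.
set Q := rees_quotient _ => -[f [g fK gK]].
(* All triples lie in the ideal, so the quotient is a single point, whereas [None] and [Some (0, 0)]
   differ. *)
suff /(can_inj gK) : g None = g (Some (0, 0)%N) by [].
rewrite -[g None]reprK -[g (Some _)]reprK.
by apply/rees_pi_eq/orP; right; apply/andP; split; apply/mem_set; apply: allE.
Qed.

Lemma isomorphic_matrix_units_point (A B : set int) (a b : int) :
  isomorphic (BZ Fclosed) matrix_units ->
  F A -> F B -> A a -> B b -> a = b.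
Proof.
move=> iso.
wlog lt_ba : A B a b / b < a.
  move=> W FA FB Aa Bb; case: (ltgtP a b) => [lt|gt|//].
    by rewrite (W B A b a).
  exact: (W A B a b).
move=> FA FB Aa Bb; exfalso.
have F0 := isomorphic_matrix_units_set0 iso.
move: iso; rewrite /BZ; case: pselect => // {}F0.
set Q := rees_quotient _ => -[f [g fK gK]].
pose p (x : T) : matrix_units := f (\pi_Q x).
have pM x y : p (x * y)%g = (p x * p y)%g.
  by rewrite /p -rees_mulE; exact: gmulfM.
have pE x y : p x = p y -> rees_rel (empty_triples (Fclosed := Fclosed)) x y.
  by move=> /(can_inj fK)/rees_pi_eq.
(* If z represents the preimage of [None] and e is the empty triple, then e and e * z both lie in
   the ideal, so p e = p e * p z = [None]. *)
have p0 : p (triple 0 0 F0) = None.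
  have pz : p (repr (g None)) = None by rewrite /p reprK gK.
  rewrite -(matrix_units_mul0 (p (triple 0 0 F0))) -pz -pM. congr (f _).
  apply/rees_pi_eq/orP; right; apply/andP; split; apply/mem_set => //.
  by apply: (empty_triples_ideal Fclosed F0).2; left.
have pNone x : p x = None -> (val x).2 = set0.
  rewrite -p0 => /pE /orP[/eqP -> //|/andP[/set_mem + _]].
  exact.
(* The triples differ since a - b is nonzero, and the first is outside the ideal since a is in A. *)
have e12 : p (triple 0 0 FA) <> p (triple (a - b) (a - b) FB).
  move=> /pE /orP[/eqP/(congr1 val)[]|/andP[/set_mem + _]].
    by lia.
  by rewrite /empty_triples /= => A0; move: Aa; rewrite A0.
have := @matrix_units_idem_orth (p (triple 0 0 FA))
  (p (triple (a - b) (a - b) FB)).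
rewrite -!pM !triple_idem => /(_ erefl erefl e12)/pNone /=.
rewrite subr_gt0 lt_ba /= => E.
(* Translation by b - a carries the point a of A to b. *)
have : (shift (0 - (a - b)) A `&` B) b.
  by split => //; apply/shiftE; move: Aa; congr (A _); lia.
by rewrite E.
Qed.

Lemma isomorphic_matrix_units_singleton (x : int) :
  F = [set [set x]; set0] -> isomorphic (BZ Fclosed) matrix_units.
Proof.
move=> FE; have F0 : F set0 by rewrite FE; right.
have Fx : F [set x] by rewrite FE; left.
have x0 : [set x] <> set0 by move=> /predeqP/(_ x)[/(_ erefl)].
rewrite /BZ; case: pselect => // {}F0.
pose g (t : T) : matrix_units :=
  if pselect ((val t).2 = set0) then None
  else Some (nat_of_int (val t).1.1, nat_of_int (val t).1.2).
pose h (u : matrix_units) : T :=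
  if u is Some (a, b) then triple (int_of_nat a) (int_of_nat b) Fx
  else triple 0 0 F0.
have FP (t : T) : (val t).2 = [set x] \/ (val t).2 = set0.
  have FE2 A : F A -> A = [set x] \/ A = set0 by rewrite FE.
  by apply/FE2/set_mem; apply: (valP t).
have g0 (t : T) : (val t).2 = set0 -> g t = None by rewrite /g; case: pselect.
have gx (t : T) : (val t).2 = [set x] ->
    g t = Some (nat_of_int (val t).1.1, nat_of_int (val t).1.2).
  by rewrite /g => ->; case: pselect.
apply: (@isomorphic_rees _ _ _ _ g h).
- move=> t u; have [_ I0] := empty_triples_ideal Fclosed F0.
  have [t0|tE] := pselect ((val t).2 = set0).
    by rewrite (g0 t) // g0 //; apply: I0; left.
  have [u0|uE] := pselect ((val u).2 = set0).
    by rewrite (g0 u) // matrix_units_mul0 g0 //; apply: I0; right.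
  have {}tE : (val t).2 = [set x] by case: (FP t).
  have {}uE : (val u).2 = [set x] by case: (FP u).
  rewrite (gx t) // (gx u) //.
  (* Distinct translates of a point are disjoint, so a product with unequal inner indices falls into
     the ideal, as for matrix units. *)
  have disj (m n : int) : m != n -> shift m [set x] `&` shift n [set x] = set0.
    move=> mn; rewrite -subset0 => y [/shiftE/= y1 /shiftE/= y2].
    by move/eqP: mn; apply; lia.
  have tuE : val (t * u)%g = triple_mul (val t) (val u) by [].
  move: tuE tE uE; case: (val t) (val u) => [[i j] A] [[k l] B] + AE BE.
  rewrite [A]AE [B]BE matrix_units_mulgE /triple_mul.
  rewrite [matrix_units_mul _ _]/= (can_eq nat_of_intK).
  case: (ltgtP j k) => jk tuE.
  - by apply: g0; rewrite tuE -[X in _ `&` X]shift0 disj //; lia.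
  - by apply: g0; rewrite tuE -[X in X `&` _]shift0 disj //; lia.
  - by rewrite gx tuE // setIid.
- move=> t u; split.
    case/orP => [/eqP -> //|/andP[/set_mem t0 /set_mem u0]].
    by rewrite !g0.
  case: (FP t) => tE; case: (FP u) => uE;
    rewrite ?(gx t tE) ?(gx u uE) ?(g0 t tE) ?(g0 u uE) //.
    case=> /(can_inj nat_of_intK) + /(can_inj nat_of_intK).
    move=> ij kl; apply/orP; left; apply/eqP/val_inj; move: tE uE ij kl => /=.
    by case: (sval t) (sval u) => [[? ?] ?] [[? ?] ?] /= -> -> -> ->.
  by move=> _; apply/orP; right; apply/andP; split; apply/mem_set.
- case=> [[a b]|]; last by rewrite g0.
  by rewrite gx //= !int_of_natK.
Qed.

End Triples.

Theorem mainTheorem10 (F : set (set int))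
    (Fomega : F `<=` [set A | A `<=` omega]) (Fclosed : omega_closed F) :
  isomorphic (BZ Fclosed) matrix_units <->
  exists2 x : int, omega x & F = [set [set x]; set0].
Proof.
split=> [iso|[x _ FE]]; last exact: isomorphic_matrix_units_singleton FE.
have F0 := isomorphic_matrix_units_set0 iso.
have [A FA [x Ax]] := isomorphic_matrix_units_nonempty iso.
have AE (B : set int) (b : int) : F B -> B b -> B = [set x].
  move=> FB Bb; apply/predeqP => c; split=> /= [Bc|->].
    by apply/esym; apply: (isomorphic_matrix_units_point iso FA FB).
  by rewrite (isomorphic_matrix_units_point iso FA FB Ax Bb).
exists x; first exact: Fomega FA x Ax.
(* The singleton of x belongs to the family because it is A itself. *)
apply/predeqP => B; split=> [FB|[]->//]; last by rewrite -(AE A x).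
have [->|/set0P[b Bb]] := eqVneq B set0; first by right.
by left; apply: AE Bb.
Qed.
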